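(* Let $m\in\mathbb N$, $p\in(1,2]$ and $f=(f_1,\dots,f_m)\in L^p_{\mathbb F}(0,T;\mathbb R^m)$. Then for almost every $t\in[0,T]$ there exists a sequence $\{\varepsilon_n^{(t)}\}_{n\ge1}$ of positive numbers, depending on $t$, such that $\lim_{n\to\infty}\varepsilon_n^{(t)}=0$ and, almost surely, $$\lim_{n\to\infty}\frac1{\varepsilon_n^{(t)}}\int_t^{t+\varepsilon_n^{(t)}}\mathbb E_t|f_i(s)-f_i(t)|\,ds=0,\qquad i=1,2,\dots,m.$$
   Context: $(\Omega,\mathcal F,\mathbb P,\mathbb F=\{\mathcal F_t\}_{t\ge0})$ is a filtered complete probability space, $T>0$, and $\mathbb E_t[\cdot]=\mathbb E[\cdot|\mathcal F_t]$. $L^p_{\mathbb F}(0,T;\mathbb R^m)$ is the space of measurable $\mathbb F$-adapted $\mathbb R^m$-valued processes $f$ on $[0,T]\times\Omega$ with $\mathbb E\int_0^T|f(s)|^pds<\infty$. *)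

(* Defs.v *)
From HB Require Import structures.
From mathcomp Require Import all_boot all_order all_algebra.
From mathcomp Require Import all_classical all_reals all_analysis.
From mathcomp Require Import measurable_realfun.
Set Implicit Arguments.
Unset Strict Implicit.
Unset Printing Implicit Defensive.
Import Order.TTheory GRing.Theory Num.Theory.
Import numFieldNormedType.Exports.
Local Open Scope classical_set_scope.
Local Open Scope ring_scope.

(* Only the values of [F] at nonnegative times are constrained. Right
   continuity and the inclusion of the null sets in [F 0] are not required. *)
Definition filtration (R : realType) (d : measure_display)
    (Omega : measurableType d) (F : R -> set (set Omega)) : Prop :=
  (forall t, 0 <= t -> sigma_algebra setT (F t) /\ F t `<=` measurable) /\
  (forall s t, 0 <= s -> s <= t -> F s `<=` F t).

Definition measurable_wrt (d : measure_display) (Omega : measurableType d)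
    (d' : measure_display) (E : measurableType d') (G : set (set Omega))
    (X : Omega -> E) : Prop :=
  measurable_fun [set: g_sigma_algebraType G] (X : g_sigma_algebraType G -> E).

Definition eucl_norm (R : realType) (m : nat) (x : 'rV[R]_m) : R :=
  Num.sqrt (\sum_(i < m) x ord0 i ^+ 2).

(* A process on [a, b] is a function on R * Omega whose values at times outside
   [a, b] are irrelevant. *)
Definition measurable_process (R : realType) (d : measure_display)
    (Omega : measurableType d) (d' : measure_display) (E : measurableType d')
    (a b : R) (X : R -> Omega -> E) : Prop :=
  measurable_fun (`[a, b] `*` [set: Omega]) (fun z : R * Omega => X z.1 z.2).

(* Measurability for the Borel sigma-algebra of R^m, which is the product one,
   is expressed coordinatewise. *)
Definition Lp_adapted (R : realType) (d : measure_display)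
    (Omega : measurableType d) (P : probability Omega R)
    (F : R -> set (set Omega)) (p T : R) (m : nat)
    (f : R -> Omega -> 'rV[R]_m) : Prop :=
  [/\ forall i, measurable_process 0 T (fun s w => f s w ord0 i),
      forall i s, 0 <= s <= T -> measurable_wrt (F s) (fun w => f s w ord0 i) &
      (\int[P]_w \int[@lebesgue_measure R]_(s in `[0%R, T])
         (eucl_norm (f s w) `^ p)%:E < +oo)%E].

(* [Y] is a version of E[X | G], for [X] integrable or nonnegative. In the
   integrable case [Y] is integrable (take A = {0 < Y} and A = {Y < 0}); in the
   nonnegative case the value +oo is allowed, so that a version always exists. *)
Definition is_condE (R : realType) (d : measure_display)
    (Omega : measurableType d) (P : probability Omega R)
    (G : set (set Omega)) (X Y : Omega -> \bar R) : Prop :=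
  measurable_wrt G Y /\
  forall A, G A -> (\int[P]_(w in A) Y w = \int[P]_(w in A) X w)%E.

(* A conditional expectation being defined up to a null set that may depend on
   the time s, the pathwise integral of s |-> E[X s | G] refers to a jointly
   measurable version of this process. *)
Definition is_condE_process (R : realType) (d : measure_display)
    (Omega : measurableType d) (P : probability Omega R)
    (G : set (set Omega)) (a b : R) (X Y : R -> Omega -> \bar R) : Prop :=
  measurable_process a b Y /\
  forall s, a <= s <= b -> is_condE P G (X s) (Y s).

(* Main.v *)
Require Import Defs.
From HB Require Import structures.
From mathcomp Require Import all_boot all_order all_algebra.
From mathcomp Require Import all_classical all_reals all_analysis.
From mathcomp Require Import measurable_realfun.
From mathcomp Require Import ring.
Import Order.TTheory GRing.Theory Num.Theory.
Import numFieldNormedType.Exports.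
Local Open Scope classical_set_scope.
Local Open Scope ring_scope.

(** The statement asks for a single sequence of radii at each time t, so it
    is enough to have the averages tend to 0 in mean: along radii for which the
    mean of the n-th average is at most 2^-n, the averages are summable in mean,
    hence almost surely summable, and so tend to 0 almost surely
    ([ae_cvg0_summable]). By Tonelli, and because conditioning preserves
    expectations, the mean of the average over [t, t + r] is
        r^-1 * \int_t^(t + r) E|f_i(s) - f_i(t)| ds,
    whatever versions of the conditional expectations are used
    ([ae_condE_avg_cvg0]). So the point is that almost every t is a Lebesgue
    point of s |-> f_i(s) seen as a function with values in L^1(Omega)
    ([ae_L1_lebesgue_pt]). Local integrability of f_i in mean comes from
    |x| <= 1 + |x|^p.

    The L^1(Omega)-valued differentiation theorem is deduced from the scalar one
    by induction on nonnegative measurable functions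
    ([nonneg_measurable_prod_ind]). For the indicator of a rectangle it is the
    scalar theorem. If X is the sum of a series of nonnegative u_i and Q_n
    denotes the n-th tail of that series, then
        |X(s) - X(t)| <= \sum_(i < n) |u_i(s) - u_i(t)| + Q_n(s) + Q_n(t),
    where the partial sum is harmless; the scalar theorem for s |-> E Q_n(s)
    bounds the upper limit of the averages by 2 E Q_n(t), which is small for n
    large ([L1_lebesgue_pt_series]).

    The existence of a jointly measurable process that is a version of the
    conditional expectation at every time s, rather than at almost every s,
    follows from the same induction ([condE_version_exists]): Radon-Nikodym is
    used only for events of Omega, and countable sums of nonnegative versions
    are versions, without any exceptional set. *)
Set Implicit Arguments.
Unset Strict Implicit.
Unset Printing Implicit Defensive.

#[local] Instance ae_lebesgue_filter (R : realType) :
  Filter (nbhs (almost_everywhere (@lebesgue_measure R))).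
Proof. exact: (ae_filter_ringOfSetsType lebesgue_measure). Qed.

(** * Induction on nonnegative measurable functions *)

Section induction.
Import HBSimple HBNNSimple.
Context d (T : measurableType d) (R : realType).

Lemma cvg_nneseriesE (u : nat -> R) (l : R) :
  (forall n, 0 <= u n) -> series u n @[n --> \oo] --> l ->
  l%:E = (\sum_(0 <= n <oo) (u n)%:E)%E.
Proof.
move=> u0 ul; apply/esym/cvg_lim => //.
rewrite (_ : (fun n => _) = EFin \o series u); last first.
  by apply/funext => n; rewrite /series /= -sumEFin.
by apply: cvg_comp ul _ => //; apply: cvg_EFin => //; apply: nearW.
Qed.

(** A monotone class theorem in which the limits are sums of series. Stability
    under sums of nonnegative series is easier to check than stability under
    monotone limits: the terms need not be compared with one another. Dynkin's
    theorem gives the indicators of measurable sets; simple functions are finite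
    combinations of these, and an increasing sequence of simple functions is
    turned into a series by taking its increments. *)
Lemma nonneg_measurable_ind (G : set (set T)) (H : (T -> R) -> Prop) :
  d.-measurable = <<s G >> -> setI_closed G -> G setT ->
  (forall A, G A -> H \1_A) ->
  (forall A, measurable A -> H \1_A -> H \1_(~` A)) ->
  (forall (c : R) (X : T -> R), 0 <= c -> measurable_fun setT X -> (forall z, 0 <= X z) ->
     H X -> H (fun z => c * X z)) ->
  (forall (u : nat -> T -> R) X, (forall n, measurable_fun setT (u n)) ->
     (forall n z, 0 <= u n z) -> (forall n, H (u n)) ->
     (forall z, (X z)%:E = \sum_(0 <= n <oo) (u n z)%:E)%E -> H X) ->
  forall X : T -> R, measurable_fun setT X -> (forall z, 0 <= X z) -> H X.
Proof.
move=> gE GI GT HG HC HZ HS.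
have Hset A : measurable A -> H \1_A.
  rewrite [X in X A -> _]gE; apply: (@dynkin_induction _ _ _ (fun A => H \1_A)) => //.
  - exact: HG.
  - move=> F mF tF HF; apply: (HS (fun n => \1_(F n))) => // z.
    by rewrite indic_bigcup.
have H0 : H (fun=> 0).
  by have := Hset _ measurable0; congr H; apply/funext => z; rewrite indic0.
have HD (X Y : T -> R) : measurable_fun setT X -> measurable_fun setT Y ->
    (forall z, 0 <= X z) -> (forall z, 0 <= Y z) -> H X -> H Y ->
    H (fun z => X z + Y z).
  move=> mX mY X0 Y0 HX HY.
  (* A sum of two terms is a series padded with zeros. *)
  pose u n : T -> R := match n with 0 => X | 1 => Y | _ => fun=> 0 end.
  apply: (HS u).
  - by move=> [|[|n]] //=.
  - by move=> [|[|n]] //=.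
  - by move=> [|[|n]] //=.
  move=> z; apply: cvg_nneseriesE; first by move=> [|[|n]] /=.
  apply: cvg_near_cst; near=> n.
  have n2 : (2 <= n)%N by near: n; exists 2%N.
  have u2 : \sum_(2 <= i < n) u i z = 0.
    by rewrite big_nat_cond big1// => -[|[|i]].
  rewrite /series/= (big_cat_nat _ n2)//= u2 addr0.
  by rewrite /index_iota/= !big_cons big_nil addr0.
have Hsfun (g : {sfun T >-> R}) : (forall z, 0 <= g z) -> H g.
  move=> g0; rewrite (_ : (g : T -> R) = fun z =>
      \sum_(y <- finmap.enum_fset (fset_set (range g))) y * \1_(g @^-1` [set y]) z); last first.
    by apply/funext => z; rewrite [LHS]fimfunE fsbig_finite.
  have : all (fun y => 0 <= y) (finmap.enum_fset (fset_set (range g))).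
    apply/allP => y; rewrite in_fset_set// inE => -[z _ <-]; exact: g0.
  elim: (finmap.enum_fset _) => [_|y s IH /= /andP[y0 s0]].
    by move: H0; congr H; apply/funext => z; rewrite big_nil.
  rewrite (_ : (fun z => _) = (fun z => y * \1_(g @^-1` [set y]) z +
      \sum_(y <- s) y * \1_(g @^-1` [set y]) z)); last first.
    by apply/funext => z; rewrite big_cons.
  apply: HD.
  - exact: measurable_funM.
  - by apply: measurable_sum => // x; exact: measurable_funM.
  - by move=> z; rewrite mulr_ge0.
  - move=> z; rewrite big_seq_cond sumr_ge0// => x /andP[xs _].
    by rewrite mulr_ge0// (allP s0).
  - by apply: HZ => //; apply: Hset.
  - exact: IH.
move=> X mX X0.
have mEX : measurable_fun setT (EFin \o X) by exact/measurable_EFinP.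
pose phi := nnsfun_approx measurableT mEX.
have phile n z : phi n z <= phi n.+1 z.
  by have /lefP := nd_nnsfun_approx measurableT mEX (leqnSn n); apply.
(* The increments of phi, whose partial sums are the phi n. *)
pose u n : {sfun T >-> R} := if n is k.+1
  then (phi k.+1 : {sfun T >-> R}) - (phi k : {sfun T >-> R}) else phi 0%N.
have u0 n z : 0 <= u n z.
  by case: n => [|n] /=; [exact: fun_ge0|rewrite subr_ge0; exact: phile].
apply: (HS (fun n => u n)) => //.
  by move=> n; apply: Hsfun => z; exact: u0.
move=> z; apply: cvg_nneseriesE => //.
rewrite -(cvg_shiftS (series _)).
rewrite (_ : (fun n => _) = (fun n => phi n z)); last first.
  apply/funext => n; rewrite /series/=.
  elim: n => [|n IH]; first by rewrite big_nat1.
  by rewrite big_nat_recr//= IH addrC subrK.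
have := cvg_nnsfun_approx measurableT mEX (fun z _ => X0 z) (I : setT z).
by move=> /fine_cvg.
Unshelve. all: by end_near. Qed.

End induction.

(** The same principle on a product space: the measurable rectangles form a
    pi-system generating the product sigma-algebra. *)
Lemma nonneg_measurable_prod_ind d1 d2 (T1 : measurableType d1)
    (T2 : measurableType d2) (R : realType) (H : (T1 * T2 -> R) -> Prop) :
  (forall A B, measurable A -> measurable B -> H \1_(A `*` B)) ->
  (forall A, measurable A -> H \1_A -> H \1_(~` A)) ->
  (forall (c : R) (X : T1 * T2 -> R), 0 <= c -> measurable_fun setT X ->
     (forall z, 0 <= X z) -> H X -> H (fun z => c * X z)) ->
  (forall (u : nat -> T1 * T2 -> R) X, (forall n, measurable_fun setT (u n)) ->
     (forall n z, 0 <= u n z) -> (forall n, H (u n)) ->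
     (forall z, (X z)%:E = \sum_(0 <= n <oo) (u n z)%:E)%E -> H X) ->
  forall X : T1 * T2 -> R, measurable_fun setT X -> (forall z, 0 <= X z) -> H X.
Proof.
move=> HR; apply: (nonneg_measurable_ind
    (G := [set A `*` B | A in measurable & B in measurable])).
- exact: measurable_prod_measurableType.
- move=> _ _ [A1 mA1 [A2 mA2 <-]] [B1 mB1 [B2 mB2 <-]].
  exists (A1 `&` B1); first exact: measurableI.
  exists (A2 `&` B2); first exact: measurableI.
  by rewrite setXI.
- by exists setT => //; exists setT => //; rewrite setXTT.
- by move=> _ [A mA [B mB <-]]; exact: HR.
Qed.

(** * Versions of conditional expectations *)

Section condE.
Context d (Omega : measurableType d) (R : realType) (P : probability Omega R).
Variable G : set (set Omega).
Hypotheses (sG : sigma_algebra setT G) (Gm : G `<=` measurable).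

Local Notation GT := (g_sigma_algebraType G).

Lemma measurable_g_sigma_algebraE (A : set GT) : measurable A <-> G A.
Proof.
split; first by apply: smallest_sub.
by move=> GA; apply: sub_sigma_algebra.
Qed.

Lemma measurable_id_g_sigma_algebra : measurable_fun setT (id : Omega -> GT).
Proof. by move=> _ A /measurable_g_sigma_algebraE GA; rewrite setTI preimage_id; exact: Gm. Qed.

Lemma measurable_wrtW d' (E : measurableType d') (X : Omega -> E) :
  measurable_wrt G X -> measurable_fun setT X.
Proof.
move=> mX _ B mB; rewrite setTI; apply: Gm.
by apply/measurable_g_sigma_algebraE; rewrite -[X in measurable X]setTI; exact: mX.
Qed.

(** The Radon-Nikodym derivative, on the sigma-algebra [G], of the trace of [P]
    on [A] with respect to [P]. Both measures are carried to [G] by pushing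
    forward along the identity. *)
Lemma condE_indic_exists A : measurable A ->
  exists Z : Omega -> \bar R, [/\ forall w, (0 <= Z w)%E, measurable_wrt G Z &
    forall B, G B -> (\int[P]_(w in B) Z w = P (A `&` B))%E].
Proof.
move=> mA.
have idm := measurable_id_g_sigma_algebra.
pose Q0 : {measure set GT -> \bar R} := pushforward P (id : Omega -> GT).
pose Q := Q0 idm.
pose N0 : {measure set GT -> \bar R} := pushforward (mrestr P mA) (id : Omega -> GT).
pose N := N0 idm.
have Qfin : fin_num_fun Q.
  by move=> B /measurable_g_sigma_algebraE GB; rewrite fin_num_measure//; exact: Gm.
have Nfin : fin_num_fun N.
  by move=> B /measurable_g_sigma_algebraE GB; rewrite /N/= /pushforward fin_num_measure//; exact: Gm.
pose Q' : {finite_measure set GT -> \bar R} :=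
  HB.pack (Q : set GT -> \bar R) (Measure.on Q)
    (Measure_isFinite.Build _ _ _ (Q : set GT -> \bar R) Qfin).
pose N' : {finite_measure set GT -> \bar R} :=
  HB.pack (N : set GT -> \bar R) (Measure.on N)
    (Measure_isFinite.Build _ _ _ (N : set GT -> \bar R) Nfin).
have NQ : N' `<< Q'.
  apply/null_content_dominatesP => B /measurable_g_sigma_algebraE GB.
  rewrite /N'/Q'/= /pushforward/= /mrestr preimage_id => PB0.
  apply/eqP; rewrite -measure_le0 -PB0 le_measure ?inE//; [|exact: Gm].
  by apply: measurableI => //; exact: Gm.
have [Z [Z0 Zint ZE]] := radon_nikodym_finite NQ.
exists Z; split => //.
  exact: measurable_int Zint.
move=> B GB.
have mZ := measurable_int _ Zint.
transitivity (N' B); last by rewrite /N'/= /pushforward/= /mrestr setIC.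
rewrite ZE; last exact/measurable_g_sigma_algebraE.
rewrite [RHS](@ge0_integral_pushforward _ _ _ _ _ (id : Omega -> GT))//.
- exact/measurable_g_sigma_algebraE.
- exact: measurable_funS mZ.
Qed.

(** On the event Z > 1 the integral of Z is at most the probability of that
    event, so the nonnegative function Z - 1 has integral 0 there. *)
Lemma condE_indic_le1 A Z : measurable A ->
  (forall w, (0 <= Z w)%E) -> measurable_wrt G Z ->
  (forall B, G B -> (\int[P]_(w in B) Z w = P (A `&` B))%E) ->
  {ae P, forall w, (Z w <= 1)%E}.
Proof.
move=> mA Z0 mZ ZE.
pose N := [set w | (1 < Z w)%E].
have GN : G N.
  apply/measurable_g_sigma_algebraE; rewrite -[X in measurable X]setTI.
  exact: (@emeasurable_fun_o_infty _ GT).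
have mN := Gm GN.
have mZ' := measurable_funS measurableT (@subsetT _ N) (measurable_wrtW mZ).
have mZ1 : measurable_fun N (fun w => Z w - 1)%E.
  by apply: emeasurable_funB.
have intN0 : (\int[P]_(w in N) `|Z w - 1| = 0)%E.
  rewrite (eq_integral (fun w => Z w - 1)%E); last first.
    by move=> w; rewrite inE => Nw; rewrite gee0_abs// sube_ge0// ltW.
  apply/eqP; rewrite eq_le integral_ge0 ?andbT; last first.
    by move=> w Nw; rewrite sube_ge0// ltW.
  have : (\int[P]_(w in N) Z w <= P N)%E.
    by rewrite ZE// le_measure ?inE//; exact: measurableI.
  rewrite [X in (X <= P N)%E -> _](eq_integral (fun w => 1 + (Z w - 1))%E); last first.
    by move=> w _; rewrite [RHS]addeC subeK.
  rewrite ge0_integralD//; last by move=> w Nw; rewrite sube_ge0// ltW.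
  by rewrite integral_cst// mul1e -[X in (_ <= X)%E -> _]adde0 leeD2lE// fin_num_measure.
have /(ae_eq_integral_abs _ mN mZ1) := intN0.
apply: filterS => w /= h; rewrite leNgt; apply/negP => Nw.
have := h Nw; have := Nw; case: (Z w) => [r| |]//.
by rewrite lte_fin => r1 [] /eqP; rewrite subr_eq0 => /eqP re; rewrite re ltxx in r1.
Qed.

(** The truncation at 0 keeps the version nonnegative everywhere and not just
    almost everywhere, as required for summing versions. *)
Lemma condE_indic_setC A (Z : Omega -> \bar R) : measurable A ->
  (forall w, (0 <= Z w)%E) -> measurable_wrt G Z ->
  (forall B, G B -> (\int[P]_(w in B) Z w = P (A `&` B))%E) ->
  forall B, G B -> (\int[P]_(w in B) maxe (1 - Z w) 0 = P (~` A `&` B))%E.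
Proof.
move=> mA Z0 mZ ZE B GB.
have mB := Gm GB.
have mZ' := measurable_funS measurableT (@subsetT _ B) (measurable_wrtW mZ).
have mM : measurable_fun B (fun w => maxe (1 - Z w) 0)%E.
  by apply: measurable_maxe => //; exact: emeasurable_funB.
have PB : (\int[P]_(w in B) (Z w + maxe (1 - Z w) 0) = P B)%E.
  rewrite (@ae_eq_integral _ _ _ _ _ (cst 1%E))//.
  - by rewrite integral_cst// mul1e.
  - exact: emeasurable_funD.
  - have := condE_indic_le1 mA Z0 mZ ZE.
    apply: filterS => w h _; rewrite max_l ?sube_ge0 ?orbT//.
    move: h (Z0 w); case: (Z w) => // r _ _.
    by rewrite -EFinB -EFinD addrC subrK.
move: PB; rewrite ge0_integralD// ?ZE//; last by move=> w _; rewrite le_max lexx orbT.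
have -> : P B = (P (A `&` B) + P (~` A `&` B))%E.
  rewrite -measureU.
  - by rewrite -setIUl setUv setTI.
  - exact: measurableI.
  - by apply: measurableI => //; exact: measurableC.
  - by rewrite setIACA setICr set0I.
have finAB : P (A `&` B) \is a fin_num.
  by rewrite fin_num_measure//; exact: measurableI.
move=> /(congr1 (fun x => x - P (A `&` B))%E).
by rewrite addeAC subee// add0e [in RHS]addeAC subee// add0e.
Qed.

(** A version may be negative on a null set and may have infinite integral,
    so the expectation is split along the event Y < 0, which belongs to [G]: the
    integral of Y over it is both nonpositive and equal to that of X. *)
Lemma condE_integral_abs (X Y : Omega -> \bar R) : measurable_fun setT X ->
  (forall w, (0 <= X w)%E) -> is_condE P G X Y ->
  (\int[P]_w `|Y w| = \int[P]_w X w)%E.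
Proof.
move=> mX X0 [mY YE].
pose N := [set w | (Y w < 0)%E].
have GN : G N.
  apply/measurable_g_sigma_algebraE; rewrite -[X in measurable X]setTI.
  exact: (@emeasurable_fun_infty_o _ GT).
have GNC : G (~` N) by apply/measurable_g_sigma_algebraE/measurableC/measurable_g_sigma_algebraE.
have mN := Gm GN; have mNC := Gm GNC.
have mY' := measurable_wrtW mY.
have maY : measurable_fun setT (fun w => `|Y w|)%E by exact: measurableT_comp.
have NE : (\int[P]_(w in N) `|Y w| = \int[P]_(w in N) X w)%E.
  have h : (- (\int[P]_(w in N) `|Y w|) = \int[P]_(w in N) X w)%E.
    rewrite -integral_ge0N// -YE//; apply: eq_integral => w; rewrite inE => Nw.
    by rewrite lte0_abs// oppeK.
  have X0' : (0 <= \int[P]_(w in N) X w)%E by exact: integral_ge0.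
  have Y0 : (0 <= \int[P]_(w in N) `|Y w|)%E by exact: integral_ge0.
  move: X0'; rewrite -h oppe_ge0 => Y0'.
  have -> : (\int[P]_(w in N) `|Y w| = 0)%E by apply/eqP; rewrite eq_le Y0 Y0'.
  by rewrite oppe0.
have CE : (\int[P]_(w in ~` N) `|Y w| = \int[P]_(w in ~` N) X w)%E.
  rewrite -YE//; apply: eq_integral => w; rewrite inE => /negP.
  by rewrite -leNgt => Yw; rewrite gee0_abs.
have NC : [disjoint N & ~` N] by apply/disj_set2P; rewrite setICr.
rewrite -(setUv N) ge0_integral_setU ?setUv// NE CE.
by rewrite -[in RHS](setUv N) ge0_integral_setU ?setUv.
Qed.

End condE.

Section condE_process.
Context d1 (T : measurableType d1) d (Omega : measurableType d) (R : realType).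
Variables (P : probability Omega R) (G : set (set Omega)).
Hypotheses (sG : sigma_algebra setT G) (Gm : G `<=` measurable).

(** Versions chosen separately for each parameter s have no reason to be jointly
    measurable in (s, w). Here the dependence on s is built in from the start: a
    rectangle A x B gets the version 1_A(s) * E[1_B | G](w), and the operations
    of the induction preserve joint measurability. The values lie in the extended
    reals since X(s, .) may have infinite expectation. *)
Lemma condE_version_exists (X : T * Omega -> R) :
  measurable_fun setT X -> (forall z, 0 <= X z) ->
  exists Y : T -> Omega -> \bar R, [/\ forall s w, (0 <= Y s w)%E,
    measurable_fun setT (fun z : T * Omega => Y z.1 z.2),
    forall s, measurable_wrt G (Y s) &
    forall s A, G A -> (\int[P]_(w in A) Y s w = \int[P]_(w in A) (X (s, w))%:E)%E].
Proof.
have intE (A : set (T * Omega)) s B : measurable A -> G B ->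
    (\int[P]_(w in B) (\1_A (s, w) : R)%:E = P (xsection A s `&` B))%E.
  move=> mA GB; rewrite -integral_indic//; last 2 first.
    exact: Gm.
    exact: measurable_xsection.
  by apply: eq_integral => w _; rewrite !indicE mem_xsection.
move: X; apply: nonneg_measurable_prod_ind.
- move=> A B mA mB.
  have [Z [Z0 mZ ZE]] := condE_indic_exists P sG Gm mB.
  exists (fun s w => (\1_A s)%:E * Z w)%E; split.
  + by move=> s w; rewrite mule_ge0.
  + apply: emeasurable_funM.
      apply/measurable_EFinP.
      exact: (@measurableT_comp _ _ _ _ _ _ (\1_A : T -> R) _ fst).
    exact: (measurableT_comp (measurable_wrtW sG Gm mZ) measurable_snd).
  + move=> s; apply: (@emeasurable_funM _ (g_sigma_algebraType G)); [exact: measurable_cst|exact: mZ].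
  + move=> s C GC; rewrite intE//; last exact: measurableX.
    rewrite ge0_integralZl//; [|exact: Gm|exact: measurable_funS (measurable_wrtW sG Gm mZ)].
    rewrite ZE// indicE; case: (boolP (s \in A)) => [sA|sA].
      by rewrite mul1e in_xsectionX.
    by rewrite notin_xsectionX// set0I mul0e measure0.
- move=> A mA [Y [Y0 mY GY YE]].
  exists (fun s w => maxe (1 - Y s w) 0)%E; split.
  + by move=> s w; rewrite le_max lexx orbT.
  + by apply: measurable_maxe => //; exact: emeasurable_funB.
  + move=> s; apply: (@measurable_maxe _ (g_sigma_algebraType G)) => //.
    by apply: (@emeasurable_funB _ (g_sigma_algebraType G)); [exact: measurable_cst|exact: GY].
  + move=> s B GB; rewrite intE//; last exact: measurableC.
    rewrite (@condE_indic_setC _ _ _ _ _ sG Gm (xsection A s))//.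
      by rewrite !xsectionE.
      exact: measurable_xsection.
    by move=> C GC; rewrite YE// intE.
- move=> c X c0 mX X0 [Y [Y0 mY GY YE]].
  exists (fun s w => c%:E * Y s w)%E; split.
  + by move=> s w; rewrite mule_ge0.
  + by apply: emeasurable_funM.
  + move=> s; apply: (@emeasurable_funM _ (g_sigma_algebraType G)); [exact: measurable_cst|exact: GY].
  + move=> s A GA; rewrite ge0_integralZl//; last 2 first.
      exact: Gm.
      exact: measurable_funS (measurable_wrtW sG Gm (GY s)).
    rewrite YE// -ge0_integralZl//.
    * exact: Gm.
    * apply/measurable_EFinP/measurable_funTS.
      exact: (measurableT_comp mX (pair1_measurable s)).
    * by move=> w _; rewrite lee_fin.
- move=> u X mu u0 /choice[Y HY] XE.
  exists (fun s w => \sum_(0 <= n <oo) Y n s w)%E; split.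
  + by move=> s w; apply: nneseries_ge0 => n _ _; have [] := HY n.
  + apply: ge0_emeasurable_sum => n *; have [Y0 mY _ _] := HY n => //.
  + move=> s; apply: (@ge0_emeasurable_sum _ (g_sigma_algebraType G)) => n *.
      by have [] := HY n.
    by have [_ _ + _] := HY n; apply.
  + move=> s A GA; have mA := Gm GA.
    under [RHS]eq_integral do rewrite XE.
    rewrite !integral_nneseries//.
    * by apply: eq_eseriesr => n _; have [_ _ _ ->] := HY n.
    * move=> n; have [_ _ mY _] := HY n.
      exact: measurable_funS (measurable_wrtW sG Gm (mY s)).
    * by move=> n w _; have [] := HY n.
    * move=> n; apply/measurable_EFinP/measurable_funTS.
      exact: (measurableT_comp (mu n) (pair1_measurable s)).
    * by move=> n w _; rewrite lee_fin.
Qed.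
End condE_process.

(** * Upper limits of right averages *)

Section averages.
Context (R : realType).
Local Notation mu := (@lebesgue_measure R).
Implicit Types (phi psi : R -> \bar R) (t c : R).

(** The upper limit, as r tends to 0 from the right, of the average of [phi] over
    [t, t + r] is at most [c]; multiplying by r avoids dividing, and taking
    upper limits, in the extended reals. *)
Definition right_avg_le phi t c := forall e : R, 0 < e -> \forall r \near 0^'+,
  (\int[mu]_(s in `[t, (t + r)%R]) phi s <= ((c + e) * r)%:E)%E.

Lemma right_avg_le_mono phi psi t c :
  measurable_fun setT phi -> measurable_fun setT psi ->
  (forall s, (0 <= phi s)%E) -> (forall s, (0 <= psi s)%E) ->
  {ae mu, forall s, (phi s <= psi s)%E} ->
  right_avg_le psi t c -> right_avg_le phi t c.
Proof.
move=> mphi mpsi phi0 psi0 le psic e e0.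
near=> r; apply: (@le_trans _ _ (\int[mu]_(s in `[t, (t + r)%R]) psi s)%E).
  apply: ae_ge0_le_integral => //.
  - exact: measurable_funTS.
  - exact: measurable_funTS.
  - by move: le; apply: filterS => s + _.
by near: r; exact: psic.
Unshelve. all: by end_near. Qed.

Lemma right_avg_leD phi psi t c c' :
  measurable_fun setT phi -> measurable_fun setT psi ->
  (forall s, (0 <= phi s)%E) -> (forall s, (0 <= psi s)%E) ->
  right_avg_le phi t c -> right_avg_le psi t c' ->
  right_avg_le (fun s => phi s + psi s)%E t (c + c').
Proof.
move=> mphi mpsi phi0 psi0 phic psic e e0; near=> r.
rewrite ge0_integralD//; [|exact: measurable_funTS..].
rewrite (_ : (c + c' + e) * r = (c + e / 2) * r + (c' + e / 2) * r); last by field.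
rewrite EFinD leeD//; near: r.
- by apply: phic; rewrite divr_gt0.
- by apply: psic; rewrite divr_gt0.
Unshelve. all: by end_near. Qed.

Lemma right_avg_le_widen phi t c c' : c <= c' -> right_avg_le phi t c -> right_avg_le phi t c'.
Proof.
move=> cc' phic e e0; near=> r; have r0 : 0 < r by [].
apply: (@le_trans _ _ ((c + e) * r)%:E); first by near: r; exact: phic.
by rewrite lee_fin ler_wpM2r ?(ltW r0)// lerD2r.
Unshelve. all: by end_near. Qed.

Lemma right_avg_le_closed phi t c : (forall e, 0 < e -> right_avg_le phi t (c + e)) -> right_avg_le phi t c.
Proof.
move=> H e e0; have e20 : 0 < e / 2 by rewrite divr_gt0.
by have := H _ e20 _ e20; rewrite -addrA -splitr.
Qed.

(** The tolerance is divided by k + 1 rather than by k to cover k = 0. *)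
Lemma right_avg_leZ phi t c k : 0 <= k -> measurable_fun setT phi ->
  (forall s, (0 <= phi s)%E) -> right_avg_le phi t c ->
  right_avg_le (fun s => k%:E * phi s)%E t (k * c).
Proof.
move=> k0 mphi phi0 phic e e0; near=> r.
have r0 : 0 < r by [].
rewrite ge0_integralZl//; last exact: measurable_funTS.
have : (\int[mu]_(s in `[t, (t + r)%R]) phi s <= ((c + e / (k + 1)) * r)%:E)%E.
  by near: r; apply: phic; rewrite divr_gt0// ltr_wpDl.
move=> /(lee_wpmul2l _)-/(_ k%:E); rewrite lee_fin => /(_ k0) /le_trans; apply.
rewrite -EFinM lee_fin mulrA ler_wpM2r ?(ltW r0)// mulrDr lerD2l.
rewrite mulrA ler_pdivrMr ?ltr_wpDl// mulrC ler_pM2l// lerDl//.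
Unshelve. all: by end_near. Qed.

Lemma right_avg_le_cst t c : right_avg_le (fun=> c%:E) t c.
Proof.
move=> e e0; near=> r.
have r0 : 0 < r by [].
rewrite integral_cst//= lebesgue_measure_itv/= lte_fin ltrDl r0.
by rewrite -EFinD -EFinM lee_fin addrAC subrr add0r ler_wpM2r ?lerDl// ltW.
Unshelve. all: by end_near. Qed.

(** Lebesgue points are defined with centered balls: [t, t + r] is contained in
    the ball of radius 2r around t, whose measure 4r explains the constant 4. *)
Lemma lebesgue_pt_right_avg_le (f : R -> R) t : measurable_fun setT f ->
  lebesgue_pt f t -> right_avg_le (fun s => `|f s - f t|%:E) t 0.
Proof.
move=> mf ft e e0; rewrite add0r.
have [d /= d0 Hd] : \forall r \near 0^'+, (davg f t r < (e / 4)%:E)%E.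
  have : nbhs (0%E : \bar R) [set x : \bar R | (x < (e / 4)%:E)%E].
    by apply: open_nbhs_nbhs; split; [exact: open_ereal_lt_ereal|rewrite /= lte_fin divr_gt0].
  by move/ft.
near=> r.
have r0 : 0 < r by [].
have rd : r < d / 2 by near: r; apply: nbhs_right_lt; rewrite divr_gt0.
have r20 : 0 < 2 * r by rewrite mulr_gt0.
have := Hd (2 * r); rewrite /ball/= sub0r normrN gtr0_norm//.
have -> : 2 * r < d by rewrite mulrC -ltr_pdivlMr.
move=> /(_ isT r20).
rewrite /davg /iavg lebesgue_measure_ball ?(ltW r20)//.
rewrite inver mulrn_eq0/= gt_eqF// => H.
have {}H : (\int[mu]_(s in ball t (2 * r)) `|(f s - f t)%:E| <= (e * r)%:E)%E.
  move: H; set I := (X in (_ * X < _)%E -> _) => H.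
  have -> : (\int[mu]_(s in ball t (2 * r)) `|(f s - f t)%:E| = I)%E by [].
  have := lee_wpmul2l _ (ltW H) => /(_ (2 * r *+ 2)%:E).
  rewrite lee_fin mulrn_wge0 ?(ltW r20)// => /(_ isT).
  rewrite muleA -EFinM divff ?mul1e ?mulrn_eq0 ?gt_eqF//.
  rewrite -EFinM (_ : 2 * r *+ 2 * (e / 4) = e * r)//.
  by rewrite -mulr_natl; field.
apply: le_trans H.
apply: ge0_subset_integral => //.
- exact: measurable_ball.
- do 2 apply: measurableT_comp => //; apply: measurable_funB => //.
  exact: measurable_funTS.
- move=> s; rewrite /= in_itv/= => /andP[ts str].
  by rewrite /ball/= distrC ger0_norm ?subr_ge0// ltrBlDl
    (le_lt_trans str)// ltrD2l ltr_pMl// ltr1n.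
Unshelve. all: by end_near. Qed.

End averages.

(** * Lebesgue points of processes in mean *)

Section L1_lebesgue.
Context (R : realType) d (Omega : measurableType d) (P : probability Omega R).
Local Notation mu := (@lebesgue_measure R).
Implicit Types (X : R * Omega -> R).

Definition L1_dist X (t s : R) : \bar R := (\int[P]_w `|X (s, w) - X (t, w)|%:E)%E.

Definition L1_lebesgue_pt X t := right_avg_le (L1_dist X t) t 0.

Definition L1_locally_integrable X := forall K : set R, compact K ->
  (\int[mu]_(s in K) \int[P]_w `|X (s, w)|%:E < +oo)%E.

Lemma L1_dist_ge0 X t s : (0 <= L1_dist X t s)%E.
Proof. by apply: integral_ge0 => w _; rewrite lee_fin. Qed.

Lemma measurable_L1_norm (X : R * Omega -> R) : measurable_fun setT X ->
  measurable_fun setT (fun s => \int[P]_w `|X (s, w)|%:E)%E.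
Proof.
move=> mX; apply: (@measurable_fun_fubini_tonelli_F _ _ _ _ _ P (fun z => `|X z|%:E)) => //.
by apply/measurable_EFinP; exact: measurableT_comp.
Qed.

Lemma measurable_section X t : measurable_fun setT X ->
  measurable_fun setT (fun w => X (t, w)).
Proof. by move=> mX; exact: (measurableT_comp mX (pair1_measurable t)). Qed.

Lemma measurable_L1_dist X t : measurable_fun setT X ->
  measurable_fun setT (L1_dist X t).
Proof.
move=> mX; apply: (@measurable_L1_norm (fun z => X z - X (t, z.2))).
apply: measurable_funB => //.
exact: (measurableT_comp (measurable_section t mX) measurable_snd).
Qed.

Lemma measurable_dist_section X s t : measurable_fun setT X ->
  measurable_fun setT (fun w => `|X (s, w) - X (t, w)|%:E).
Proof.
move=> mX; apply/measurable_EFinP; apply: measurableT_comp => //.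
by apply: measurable_funB; exact: measurable_section.
Qed.

Lemma L1_dist_le (X Y : R * Omega -> R) t s : measurable_fun setT X ->
  measurable_fun setT Y ->
  (forall w, `|X (s, w) - X (t, w)| <= `|Y (s, w) - Y (t, w)|) ->
  (L1_dist X t s <= L1_dist Y t s)%E.
Proof.
move=> mX mY XY; apply: ge0_le_integral => //.
- exact: measurable_dist_section.
- exact: measurable_dist_section.
- by move=> w _; rewrite lee_fin.
Qed.

Lemma L1_lebesgue_pt_dist_le (X Y : R * Omega -> R) t : measurable_fun setT X ->
  measurable_fun setT Y ->
  (forall s w, `|X (s, w) - X (t, w)| <= `|Y (s, w) - Y (t, w)|) ->
  L1_lebesgue_pt Y t -> L1_lebesgue_pt X t.
Proof.
move=> mX mY XY; apply: right_avg_le_mono.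
- exact: measurable_L1_dist.
- exact: measurable_L1_dist.
- exact: L1_dist_ge0.
- exact: L1_dist_ge0.
- by apply: aeW => s; exact: L1_dist_le.
Qed.

Lemma L1_lebesgue_ptD (X Y Z : R * Omega -> R) t : measurable_fun setT X ->
  measurable_fun setT Y -> measurable_fun setT Z ->
  (forall s w, `|Z (s, w) - Z (t, w)| <=
    `|X (s, w) - X (t, w)| + `|Y (s, w) - Y (t, w)|) ->
  L1_lebesgue_pt X t -> L1_lebesgue_pt Y t -> L1_lebesgue_pt Z t.
Proof.
move=> mX mY mZ XYZ hX hY; rewrite /L1_lebesgue_pt -(addr0 0).
apply: right_avg_le_mono (right_avg_leD _ _ _ _ hX hY).
- exact: measurable_L1_dist.
- by apply: emeasurable_funD; exact: measurable_L1_dist.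
- exact: L1_dist_ge0.
- by move=> s; rewrite adde_ge0// L1_dist_ge0.
- apply: aeW => s; rewrite /L1_dist -ge0_integralD//; last 2 first.
  + exact: measurable_dist_section.
  + exact: measurable_dist_section.
  apply: ge0_le_integral => //.
  + exact: measurable_dist_section.
  + apply: emeasurable_funD.
      exact: measurable_dist_section.
    exact: measurable_dist_section.
  + by move=> w _; rewrite -EFinD lee_fin.
- exact: measurable_L1_dist.
- exact: measurable_L1_dist.
- exact: L1_dist_ge0.
- exact: L1_dist_ge0.
Qed.

(** The mean distance between the times s and t is at most |1_A(s) - 1_A(t)|, so
    this is the scalar differentiation theorem for the indicator of [A]. *)
Lemma L1_lebesgue_pt_rect (A : set R) (B : set Omega) : measurable A -> measurable B ->
  {ae mu, forall t, L1_lebesgue_pt \1_(A `*` B) t}.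
Proof.
move=> mA mB.
have : locally_integrable setT (\1_A : R -> R).
  split => //; first exact: openT.
  move=> K _ cK; have mK := compact_measurable cK.
  apply: (@le_lt_trans _ _ (\int[mu]_(x in K) cst 1%E x)%E); last first.
    by rewrite integral_cst// mul1e compact_finite_measure.
  apply: ge0_le_integral => //.
  - by apply/measurable_EFinP; apply: measurableT_comp.
  - by move=> x _; rewrite lee_fin ger0_norm// indicE; case: (_ \in _).
have m1A : measurable_fun setT (\1_A : R -> R) by exact: measurable_indic.
move=> /lebesgue_differentiation; apply: filterS => t /(lebesgue_pt_right_avg_le m1A).
apply: right_avg_le_mono.
- by apply: measurable_L1_dist; apply: measurable_indic; exact: measurableX.
- apply/measurable_EFinP; apply: measurableT_comp => //.
  exact: measurable_funB.
- exact: L1_dist_ge0.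
- by move=> s; rewrite lee_fin.
- apply: aeW => s; rewrite /L1_dist.
  apply: (@le_trans _ _ (\int[P]_w cst (`|\1_A s - \1_A t|%:E) w)%E).
    apply: ge0_le_integral => //.
    + apply/measurable_EFinP; apply: measurableT_comp => //.
      by apply: measurable_funB; apply: measurable_section; apply: measurable_indic; exact: measurableX.
    + move=> w _; rewrite lee_fin !indicE !in_setX/=.
      by case: (w \in B); rewrite ?andbT// !andbF subrr normr0.
  by rewrite integral_cst// [X in (_ * X)%E]probability_setT mule1.
Qed.
(** The integral over each interval [-n, n] is finite, so the integrand is finite
    almost everywhere on each of these countably many intervals. *)
Lemma L1_locally_integrable_ae X : measurable_fun setT X ->
  L1_locally_integrable X ->
  {ae mu, forall s, (\int[P]_w `|X (s, w)|%:E < +oo)%E}.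
Proof.
move=> mX LX; pose g s : \bar R := (\int[P]_w `|X (s, w)|%:E)%E.
have g0 s : (0 <= g s)%E by apply: integral_ge0 => w _; rewrite lee_fin.
have : {ae mu, forall s, forall n : nat, `[- n%:R, n%:R]%classic s -> g s \is a fin_num}.
  apply: ae_foralln => n; apply: integrable_ae => //.
  apply/integrableP; split; first by apply: measurable_funTS; exact: measurable_L1_norm.
  under eq_integral do rewrite gee0_abs//.
  by apply: LX; exact: segment_compact.
apply: filterS => s sn; rewrite -ge0_fin_numE; last exact: g0.
apply: (sn (Num.truncn `|s|).+1); rewrite /= in_itv/= -ler_norml.
exact/ltW/truncnS_gt.
Qed.

Lemma L1_lebesgue_pt_const X t : (forall s w, X (s, w) = X (t, w)) ->
  L1_lebesgue_pt X t.
Proof.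
move=> Xt e e0; near=> h.
rewrite integral0_eq ?lee_fin ?add0r ?mulr_ge0 ?(ltW e0)// => s _.
by rewrite /L1_dist integral0_eq// => w _; rewrite Xt subrr normr0.
Unshelve. all: by end_near. Qed.

Lemma L1_locally_integrable_le (X Y : R * Omega -> R) :
  measurable_fun setT X -> measurable_fun setT Y ->
  (forall z, `|X z| <= `|Y z|) ->
  L1_locally_integrable Y -> L1_locally_integrable X.
Proof.
move=> mX mY XY LY K cK; have mK := compact_measurable cK.
have mIX := measurable_L1_norm mX; have mIY := measurable_L1_norm mY.
apply: le_lt_trans (LY K cK); apply: ge0_le_integral => //.
- by move=> s _; apply: integral_ge0 => w _; rewrite lee_fin.
- exact: measurable_funTS mIX.
- exact: measurable_funTS mIY.
- move=> s _; apply: ge0_le_integral => //.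
  + apply/measurable_EFinP; apply: measurableT_comp => //.
    exact: measurable_section.
  + apply/measurable_EFinP; apply: measurableT_comp => //.
    exact: measurable_section.
  + by move=> w _; rewrite lee_fin.
Qed.

Lemma L1_locally_integrable_cst (k : R) : L1_locally_integrable (fun=> k).
Proof.
move=> K cK; have mK := compact_measurable cK.
rewrite (eq_integral (cst `|k|%:E)); last first.
  by move=> s _; rewrite integral_cst// [X in (_ * X)%E]probability_setT mule1.
by rewrite integral_cst// lte_mul_pinfty// ?compact_finite_measure ?lee_fin.
Qed.

Lemma L1_locally_integrableZ (k : R) X : measurable_fun setT X ->
  L1_locally_integrable X -> L1_locally_integrable (fun z => k * X z).
Proof.
move=> mX LX K cK; have mK := compact_measurable cK.
have mIX := measurable_L1_norm mX.
have kE s : (\int[P]_w `|k * X (s, w)|%:E =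
    `|k|%:E * \int[P]_w `|X (s, w)|%:E)%E.
  rewrite -ge0_integralZl//; first by apply: eq_integral => w _; rewrite -EFinM normrM.
  by apply/measurable_EFinP; apply: measurableT_comp => //; exact: measurable_section.
under eq_integral do rewrite kE.
rewrite ge0_integralZl//.
- by rewrite lte_mul_pinfty ?LX ?lee_fin.
- exact: measurable_funTS mIX.
- by move=> s _; apply: integral_ge0 => w _; rewrite lee_fin.
Qed.

Lemma L1_lebesgue_ptZ (k : R) X t : measurable_fun setT X ->
  L1_lebesgue_pt X t -> L1_lebesgue_pt (fun z => k * X z) t.
Proof.
move=> mX /(right_avg_leZ (normr_ge0 k) (measurable_L1_dist t mX) (L1_dist_ge0 X t)).
rewrite mulr0 /L1_lebesgue_pt.
congr (right_avg_le _ _ _); apply/funext => s.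
rewrite /L1_dist -ge0_integralZl//.
- by apply: eq_integral => w _; rewrite -mulrBr normrM EFinM.
- exact: measurable_dist_section.
Qed.

(** The step where differentiation is transferred to L^1(Omega). The
    exceptional set of times is the countable union of those of the u_n, of
    those of the scalar functions s |-> E Q_n(s), one for each tail Q_n, and of
    the set where E X(s) is infinite. *)
Lemma L1_lebesgue_pt_series (u : nat -> R * Omega -> R) X :
  (forall n, measurable_fun setT (u n)) -> (forall n z, 0 <= u n z) ->
  (forall n, {ae mu, forall t, L1_lebesgue_pt (u n) t}) ->
  measurable_fun setT X ->
  (forall z, (X z)%:E = \sum_(0 <= n <oo) (u n z)%:E)%E ->
  L1_locally_integrable X ->
  {ae mu, forall t, L1_lebesgue_pt X t}.
Proof.
move=> mu_ u0 uL mX XE LX.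
pose S n z := \sum_(i < n) u i z.
pose Q n z := X z - S n z.
have mS n : measurable_fun setT (S n) by exact: measurable_sum.
have mQ n : measurable_fun setT (Q n) by exact: measurable_funB.
have S0 n z : 0 <= S n z by exact: sumr_ge0.
have cS z : S n z @[n --> \oo] --> X z.
  rewrite (_ : (fun n => S n z) =
      fine \o (fun n => \sum_(0 <= i < n) (u i z)%:E)%E); last first.
    by apply/funext => n; rewrite /= sumEFin big_mkord.
  apply: fine_cvg; rewrite XE.
  by apply: is_cvg_nneseries => n _ _; rewrite lee_fin.
have SX n z : S n z <= X z.
  rewrite -lee_fin XE /S -sumEFin -(big_mkord xpredT (fun i => (u i z)%:E)).
  by apply: nneseries_lim_ge => k _ _; rewrite lee_fin.
have Q0 n z : 0 <= Q n z by rewrite subr_ge0.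
have QX n z : `|Q n z| <= `|X z|.
  by rewrite !ger0_norm// ?(le_trans (S0 n z))// lerBlDr lerDl.
pose r n s : \bar R := (\int[P]_w `|Q n (s, w)|%:E)%E.
have r0 n s : (0 <= r n s)%E by apply: integral_ge0 => w _; rewrite lee_fin.
have mr n : measurable_fun setT (r n) by exact: measurable_L1_norm.
have m_sec (Y : R * Omega -> R) s : measurable_fun setT Y ->
    measurable_fun setT (fun w => `|Y (s, w)|%:E).
  by move=> mY; apply/measurable_EFinP; apply: measurableT_comp => //; exact: measurable_section.
have rX n s : (r n s <= \int[P]_w `|X (s, w)|%:E)%E.
  by apply: ge0_le_integral => //; [exact: m_sec|exact: m_sec|move=> w _; rewrite lee_fin].
(* The differentiation theorem concerns real-valued functions, whence fine,
   which changes r n only on a null set of times. *)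
pose fr n s := fine (r n s).
have mfr n : measurable_fun setT (fr n) by exact: measurableT_comp.
have fr0 n s : 0 <= fr n s by exact: fine_ge0.
have Xfin := L1_locally_integrable_ae mX LX.
have Lfr n : locally_integrable setT (fr n).
  split => //; first exact: openT.
  move=> K _ cK; have mK := compact_measurable cK.
  have mafr : measurable_fun setT (fun s => `|fr n s|%:E).
    by apply/measurable_EFinP; exact: measurableT_comp.
  have mg := measurable_L1_norm mX.
  apply: le_lt_trans (LX K cK); apply: ge0_le_integral => //.
  - exact: measurable_funTS mafr.
  - exact: measurable_funTS mg.
  - move=> s _; rewrite ger0_norm//; apply: le_trans (rX n s).
    by rewrite /fr; case: (r n s) (r0 n s) => //= *; exact: leey.
have : {ae mu, forall t, forall n, lebesgue_pt (fr n) t}.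
  by apply: ae_foralln => n; exact: lebesgue_differentiation.
have : {ae mu, forall t, forall n, L1_lebesgue_pt (u n) t} by exact: ae_foralln.
move: (Xfin); apply: filterS3 => t tfin tu tr.
have LS n : L1_lebesgue_pt (S n) t.
  elim: n => [|n IH].
    by apply: L1_lebesgue_pt_const => s w; rewrite /S !big_ord0.
  apply: L1_lebesgue_ptD IH (tu n) => //.
  by move=> s w; rewrite /S !big_ord_recr/= opprD addrACA ler_normD.
have rtfin n : (fr n t)%:E = r n t.
  by rewrite fineK// ge0_fin_numE//; exact: le_lt_trans (rX n t) tfin.
have cr : r n t @[n --> \oo] --> 0%E.
  have intX : P.-integrable setT (fun w => `|X (t, w)|%:E).
    apply/integrableP; split; first exact: m_sec.
    by under eq_integral do rewrite gee0_abs ?lee_fin//.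
  have [] := @dominated_convergence _ _ _ P setT measurableT
    (fun n w => `|Q n (t, w)|%:E) (cst 0%E) _ _ _ _ intX.
  - by move=> n; exact: m_sec.
  - exact: measurable_cst.
  - apply: aeW => w _; apply: cvg_EFin; first exact: nearW.
    rewrite -(normr0 R) -(subrr (X (t, w))); apply: cvg_norm.
    by apply: cvgB => //; exact: cvg_cst.
  - by apply: aeW => w n _; rewrite gee0_abs ?lee_fin.
  by move=> _ _; rewrite integral0.
have Lr n : right_avg_le (r n) t (fr n t).
  have mD : measurable_fun setT (fun s => `|fr n s - fr n t|%:E).
    by apply/measurable_EFinP; apply: measurableT_comp => //; exact: measurable_funB.
  have := right_avg_leD mD (measurable_cst (fr n t)%:E) _ _
    (lebesgue_pt_right_avg_le (mfr n) (tr n)) (right_avg_le_cst t (fr n t)).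
  rewrite add0r => avgD; apply: right_avg_le_mono (avgD _ _) => //.
  - exact: emeasurable_funD.
  - by move=> s; rewrite -EFinD lee_fin addr_ge0.
  - move: Xfin; apply: filterS => s sfin /=.
    rewrite -(@fineK _ (r n s)); last first.
      by rewrite ge0_fin_numE//; exact: le_lt_trans (rX n s) sfin.
    by rewrite -EFinD lee_fin -/(fr n s) -lerBlDr ler_norm.
  - by move=> s; rewrite lee_fin.
rewrite /L1_lebesgue_pt; apply: right_avg_le_closed => e e0; rewrite add0r.
have [n rn] : exists n, (r n t < (e / 2)%:E)%E.
  have : nbhs (0%E : \bar R) [set x : \bar R | (x < (e / 2)%:E)%E].
    by apply: open_nbhs_nbhs; split; [exact: open_ereal_lt_ereal|rewrite /= lte_fin divr_gt0].
  by move=> /cr [n _ /(_ n)/= hn]; exists n; exact: hn.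
apply: (@right_avg_le_widen _ _ _ (0 + fr n t + fr n t)).
  by rewrite add0r (splitr e) lerD// ltW// -lte_fin rtfin.
have mD : measurable_fun setT (L1_dist (S n) t) by exact: measurable_L1_dist.
have D0 := L1_dist_ge0 (S n) t.
have mD1 : measurable_fun setT (fun s => L1_dist (S n) t s + r n s)%E.
  exact: emeasurable_funD.
have D10 s : (0 <= L1_dist (S n) t s + r n s)%E by rewrite adde_ge0.
apply: right_avg_le_mono (right_avg_leD _ _ _ _
  (right_avg_leD _ _ _ _ (LS n) (Lr n)) (right_avg_le_cst t (fr n t))) => //.
- exact: measurable_L1_dist.
- exact: emeasurable_funD.
- exact: L1_dist_ge0.
- by move=> s; rewrite adde_ge0// lee_fin.
2: by move=> _; rewrite lee_fin.
apply: aeW => s; rewrite rtfin /L1_dist /r.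
rewrite -!ge0_integralD//.
- apply: ge0_le_integral => //.
  + exact: measurable_dist_section.
  + apply: emeasurable_funD; [apply: emeasurable_funD|exact: m_sec].
      exact: measurable_dist_section.
    exact: m_sec.
  + move=> w _; rewrite -!EFinD lee_fin.
    have -> : X (s, w) - X (t, w) = (S n (s, w) - S n (t, w)) + Q n (s, w) - Q n (t, w).
      by rewrite /Q; ring.
    by rewrite (le_trans (ler_normB _ _))// lerD2r ler_normD.
- by move=> w _; rewrite adde_ge0.
- apply: emeasurable_funD; last exact: m_sec.
  exact: measurable_dist_section.
- exact: m_sec.
- exact: measurable_dist_section.
- exact: m_sec.
Qed.

(** Complementing an event changes the increments of its indicator only by a
    sign. Local integrability, a premise of the property proved by induction,
    passes from a sum to its terms by comparison, and from c * X to X by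
    multiplying by c^-1, which leaves the case c = 0 apart. *)
Lemma ae_L1_lebesgue_pt X : measurable_fun setT X -> (forall z, 0 <= X z) ->
  L1_locally_integrable X -> {ae mu, forall t, L1_lebesgue_pt X t}.
Proof.
pose H (X : R * Omega -> R) := L1_locally_integrable X ->
  {ae mu, forall t, L1_lebesgue_pt X t}.
move=> mX X0; rewrite -/(H X); move: X mX X0; apply: nonneg_measurable_prod_ind.
- by move=> A B mA mB _; exact: L1_lebesgue_pt_rect.
- move=> A mA HA _; have mA1 : measurable_fun setT (\1_A : R * Omega -> R) by exact: measurable_indic.
  have : L1_locally_integrable \1_A.
    apply: (@L1_locally_integrable_le _ (fun=> 1)) => //; last exact: L1_locally_integrable_cst.
    by move=> z; rewrite indicE normr1; case: (_ \in _); rewrite ?normr1 ?normr0.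
  move=> /HA.
  apply: filterS => t; apply: L1_lebesgue_pt_dist_le.
  + by apply: measurable_indic; exact: measurableC.
  + exact: measurable_indic.
  + move=> s w; rewrite (_ : \1_(~` A) = (fun z => 1 - \1_A z) :> (_ -> R)).
      by rewrite /= opprB addrC addrA subrK distrC.
    by apply/funext => z; rewrite !indicE in_setC; case: (_ \in _); rewrite ?subrr ?subr0.
- move=> c X c0 mX X0 HX LX.
  have [->|cn0] := eqVneq c 0.
    by apply: aeW => t; apply: L1_lebesgue_pt_const => s w; rewrite !mul0r.
  have /HX : L1_locally_integrable X.
    rewrite (_ : X = fun z => c^-1 * (c * X z)); last by apply/funext => z; rewrite mulKf.
    by apply: L1_locally_integrableZ => //; exact: measurable_funM.
  by apply: filterS => t; exact: L1_lebesgue_ptZ.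
- move=> u X mu_ u0 Hu XE LX.
  have X0 z : 0 <= X z.
    by rewrite -lee_fin XE; apply: nneseries_ge0 => n _ _; rewrite lee_fin.
  have mX : measurable_fun setT X.
    apply/measurable_EFinP; rewrite (_ : EFin \o X = (fun z => \sum_(0 <= n <oo) (u n z)%:E)%E).
      by apply: ge0_emeasurable_sum => [n z _ _|n _]; [rewrite lee_fin|exact/measurable_EFinP].
    exact/funext.
  apply: (L1_lebesgue_pt_series mu_ u0) => // n; apply: Hu.
  apply: L1_locally_integrable_le LX => // z.
  rewrite !ger0_norm// -lee_fin XE.
  apply: le_trans (nneseries_lim_ge n.+1 _); last by move=> k _ _; rewrite lee_fin.
  by rewrite big_nat_recr//= leeDr// sume_ge0// => k _; rewrite lee_fin.
Qed.
Lemma ae_L1_lebesgue_pt_real (X : R * Omega -> R) : measurable_fun setT X ->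
  L1_locally_integrable X -> {ae mu, forall t, L1_lebesgue_pt X t}.
Proof.
move=> mX LX.
pose Xp z := Num.max (X z) 0; pose Xn z := Num.max (- X z) 0.
have mXp : measurable_fun setT Xp by exact: measurable_maxr.
have mXn : measurable_fun setT Xn.
  by apply: measurable_maxr => //; exact: measurableT_comp.
have Xp0 z : 0 <= Xp z by rewrite le_max lexx orbT.
have Xn0 z : 0 <= Xn z by rewrite le_max lexx orbT.
have XE z : X z = Xp z - Xn z.
  rewrite /Xp /Xn; have [h|h] := leP 0 (X z).
    by rewrite max_r ?oppr_le0// subr0.
  by rewrite max_l ?opprK ?add0r// oppr_ge0 ltW.
have LXp : L1_locally_integrable Xp.
  apply: L1_locally_integrable_le LX => // z.
  rewrite ger0_norm// /Xp; have [_|_] := leP 0 (X z); last by [].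
  exact: ler_norm.
have LXn : L1_locally_integrable Xn.
  apply: L1_locally_integrable_le LX => // z.
  rewrite ger0_norm// /Xn ge_max normr_ge0 andbT -normrN; exact: ler_norm.
have := ae_L1_lebesgue_pt mXn Xn0 LXn.
have := ae_L1_lebesgue_pt mXp Xp0 LXp.
apply: filterS2 => t; apply: L1_lebesgue_ptD => // s w.
rewrite !XE (le_trans _ (ler_normB _ _))//.
by rewrite (_ : Xp (s, w) - _ - _ = Xp (s, w) - Xp (t, w) - (Xn (s, w) - Xn (t, w)))//; ring.
Qed.

End L1_lebesgue.

(** * From convergence in mean to almost sure convergence *)

Section summable.
Context d (Omega : measurableType d) (R : realType) (P : {measure set Omega -> \bar R}).

(** The sum of the series has finite expectation, hence is finite almost surely;
    a term is dominated by the tail of the series that it starts. *)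
Lemma ae_cvg0_summable (h : nat -> Omega -> \bar R) :
  (forall n, measurable_fun setT (h n)) -> (forall n w, (0 <= h n w)%E) ->
  (\sum_(0 <= n <oo) \int[P]_w h n w < +oo)%E ->
  {ae P, forall w, h n w @[n --> \oo] --> 0%E}.
Proof.
move=> mh h0 hoo.
pose H w := (\sum_(0 <= n <oo) h n w)%E.
have H0 w : (0 <= H w)%E by apply: nneseries_ge0.
have mH : measurable_fun setT H by exact: ge0_emeasurable_sum.
have : P.-integrable setT H.
  apply/integrableP; split => //; under eq_integral do rewrite gee0_abs//.
  by rewrite /H integral_nneseries.
move=> /(integrable_ae measurableT); apply: filterS => w /(_ I).
rewrite ge0_fin_numE// => Hw.
have := nneseries_tail_cvg Hw (fun n _ => h0 n w).
apply: squeeze_cvge; last exact: cvg_cst.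
apply: nearW => n; rewrite h0/=.
apply: le_trans (nneseries_lim_ge n.+1 _); last by move=> k _ _.
by rewrite big_nat1.
Qed.

End summable.

(** * Integrability of adapted L^p processes *)

Section strip.
Context (R : realType) d (Omega : measurableType d) (P : probability Omega R).
Local Notation mu := (@lebesgue_measure R).

Lemma measurable_strip_section d' (U : measurableType d') (A : set R)
    (Y : R * Omega -> U) w : measurable A ->
  measurable_fun (A `*` setT) Y -> measurable_fun A (fun s => Y (s, w)).
Proof.
move=> mA mY; apply: (measurable_comp (measurableX mA measurableT) _ mY).
  by move=> _ [s As <-].
exact: measurable_funTS (pair2_measurable w).
Qed.

(** Processes are measurable only on the strip where time stays in [A]; extending
    them by 0 reduces the exchange of integrals to Tonelli's theorem on the whole
    product space. *)
Lemma tonelli_strip (A : set R) (Y : R * Omega -> \bar R) : measurable A ->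
  measurable_fun (A `*` setT) Y -> (forall z, 0 <= Y z)%E ->
  measurable_fun setT (fun w => \int[mu]_(s in A) Y (s, w))%E /\
  (\int[P]_w \int[mu]_(s in A) Y (s, w) = \int[mu]_(s in A) \int[P]_w Y (s, w))%E.
Proof.
move=> mA mY Y0; pose Z := Y \_ (A `*` setT).
have mZ : measurable_fun setT Z.
  by apply/(measurable_restrictT _ _).1 => //; exact: measurableX.
have Z0 z : (0 <= Z z)%E by rewrite /Z patchE; case: ifP.
have ZA s w : Z (s, w) = if s \in A then Y (s, w) else 0%E.
  by rewrite /Z patchE in_setX in_setT andbT.
have YZ w : (\int[mu]_(s in A) Y (s, w) = \int[mu]_s Z (s, w))%E.
  by rewrite integral_mkcond; apply: eq_integral => s _; rewrite patchE ZA.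
split.
  rewrite (_ : (fun w => _) = fubini_G mu Z); last exact/funext.
  exact: measurable_fun_fubini_tonelli_G.
under eq_integral do rewrite YZ.
rewrite -(fubini_tonelli (m1 := mu) (m2 := P))// [RHS]integral_mkcond.
apply: eq_integral => s _; rewrite patchE.
case: ifPn => sA; first by apply: eq_integral => w _; rewrite ZA sA.
by rewrite integral0_eq// => w _; rewrite ZA (negbTE sA).
Qed.

Lemma coord_le_eucl_norm (m : nat) (x : 'rV[R]_m) i : `|x ord0 i| <= eucl_norm x.
Proof.
rewrite -sqrtr_sqr ler_wsqrtr// (bigD1 i)//= lerDl sumr_ge0// => j _.
exact: sqr_ge0.
Qed.

Lemma le_1_powR (x p : R) : 0 <= x -> 1 <= p -> x <= 1 + x `^ p.
Proof.
move=> x0 p1; have [x1|x1] := leP x 1.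
  by rewrite (le_trans x1)// lerDl powR_ge0.
by rewrite (le_trans (le1r_powR (ltW x1) p1))// lerDr.
Qed.

Lemma measurable_eucl_norm_powR (D : set (R * Omega)) (m : nat) (p : R)
    (f : R -> Omega -> 'rV[R]_m) : measurable D ->
  (forall i, measurable_fun D (fun z => f z.1 z.2 ord0 i)) ->
  measurable_fun D (fun z => eucl_norm (f z.1 z.2) `^ p).
Proof.
move=> mD mf.
apply: (@measurableT_comp _ _ _ _ _ _ (fun x => x `^ p)); first exact: measurable_powR.
have msqrt : measurable_fun setT (fun x : R => Num.sqrt x).
  by apply: continuous_measurable_fun; exact: sqrt_continuous.
apply: (measurableT_comp msqrt).
by apply: measurable_sum => i; exact: measurable_funX.
Qed.

(** Each coordinate is bounded by 1 + |f|^p, whose integral over [0, T] x Omega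
    is T plus the p-th moment of f. The process is extended by 0 outside
    [0, T] because differentiation is done on the whole line. *)
Lemma Lp_adapted_L1 (F : R -> set (set Omega)) (p T : R) (m : nat)
    (f : R -> Omega -> 'rV[R]_m) (i : 'I_m) : 1 <= p -> 0 <= T ->
  Lp_adapted P F p T f ->
  L1_locally_integrable P
    ((fun z : R * Omega => f z.1 z.2 ord0 i) \_ (`[0, T] `*` setT)).
Proof.
move=> p1 T0 [mf _ fp]; set X := _ \_ _; move=> K cK.
have mK := compact_measurable cK.
have mI : measurable (`[0, T]%classic : set R) by exact: measurable_itv.
have mD : measurable (`[0, T]%classic `*` [set: Omega]) by exact: measurableX.
have mX : measurable_fun setT X.
  by apply/(measurable_restrictT _ _).1 => //; exact: mf.
have m_abs : measurable_fun (`[0, T] `*` [set: Omega])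
    (fun z : R * Omega => `|f z.1 z.2 ord0 i|%:E).
  by apply/measurable_EFinP; apply: measurableT_comp => //; exact: mf.
have m_pow : measurable_fun (`[0, T] `*` [set: Omega])
    (fun z : R * Omega => (eucl_norm (f z.1 z.2) `^ p)%:E).
  by apply/measurable_EFinP; exact: measurable_eucl_norm_powR.
have [mG1 E1] := tonelli_strip mI m_abs (fun=> normr_ge0 _).
have [mG2 _] := tonelli_strip mI m_pow (fun=> powR_ge0 _ _).
have mIX := measurable_L1_norm P mX.
apply: (@le_lt_trans _ _ (\int[mu]_s \int[P]_w `|X (s, w)|%:E)%E).
  apply: ge0_subset_integral => //.
  by move=> s _; apply: integral_ge0 => w _; rewrite lee_fin.
have -> : (\int[mu]_s \int[P]_w `|X (s, w)|%:E =
    \int[mu]_(s in `[0%R, T]) \int[P]_w `|f s w ord0 i|%:E)%E.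
  rewrite [RHS]integral_mkcond; apply: eq_integral => s _; rewrite patchE.
  case: ifPn => sT.
    by apply: eq_integral => w _; rewrite /X patchE in_setX sT in_setT.
  by rewrite integral0_eq// => w _; rewrite /X patchE in_setX (negbTE sT) normr0.
rewrite -E1.
apply: (@le_lt_trans _ _ (\int[P]_w (T%:E + \int[mu]_(s in `[0%R, T])
   (eucl_norm (f s w) `^ p)%:E))%E); last first.
  rewrite ge0_integralD//; last first.
    by move=> w _; apply: integral_ge0 => s _; rewrite lee_fin powR_ge0.
  by rewrite integral_cst// [X in (_ * X)%E]probability_setT mule1 lte_add_pinfty// ltry.
have muT : mu `[0, T]%classic = T%:E.
  rewrite lebesgue_measure_itv/= lte_fin -EFinD subr0.
  by move: T0; rewrite le_eqVlt => /predU1P[<-|->//]; rewrite ltxx.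
apply: ge0_le_integral => //.
- by move=> w _; apply: integral_ge0 => s _; rewrite lee_fin.
- exact: emeasurable_funD.
- move=> w _; rewrite -muT.
  have m_absw : measurable_fun `[0, T] (fun s => `|f s w ord0 i|%:E).
    exact: (measurable_strip_section w mI m_abs).
  have m_poww : measurable_fun `[0, T] (fun s => (eucl_norm (f s w) `^ p)%:E).
    exact: (measurable_strip_section w mI m_pow).
  rewrite -[mu _]mul1e -integral_cst// -ge0_integralD//.
  + apply: ge0_le_integral => //.
      exact: emeasurable_funD.
    move=> s _; rewrite -EFinD lee_fin.
    apply: le_trans (coord_le_eucl_norm _ _) _.
    apply: le_1_powR => //; exact: sqrtr_ge0.
  + by move=> s _; rewrite lee_fin powR_ge0.
Qed.
End strip.

(** * Conditional averages along a sequence of radii *)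

Section main.
Context (R : realType) d (Omega : measurableType d) (P : probability Omega R).
Local Notation mu := (@lebesgue_measure R).

Lemma exists_condE_process (G : set (set Omega)) (a b : R) (X : R * Omega -> R)
    (D : R -> Omega -> \bar R) :
  sigma_algebra setT G -> G `<=` measurable ->
  measurable_fun setT X -> (forall z, 0 <= X z) ->
  (forall s w, a <= s <= b -> D s w = (X (s, w))%:E) ->
  exists g, is_condE_process P G a b D g.
Proof.
move=> sG Gm mX X0 DX.
have [Y [Y0 mY GY YE]] := condE_version_exists P sG Gm mX X0.
exists Y; split; first exact: measurable_funTS mY.
move=> s sab; split=> // A GA.
by rewrite YE//; apply: eq_integral => w _; rewrite DX.
Qed.

(** The same radii serve all indices: finitely many conditions that hold for all
    small radii hold simultaneously. *)
Lemma exists_summable_radii (I : finType) (phi : I -> R -> \bar R) (t T : R) :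
  t < T -> (forall i, right_avg_le (phi i) t 0) ->
  exists eps : nat -> R, [/\ forall n, 0 < eps n, forall n, t + eps n <= T,
    eps n @[n --> \oo] --> 0 &
    forall n i, (((eps n)^-1)%:E * \int[mu]_(s in `[t, (t + eps n)%R]) phi i s
      <= ((1/2) ^+ n)%:E)%E].
Proof.
move=> tT phi0.
have step n : exists e : R, [/\ 0 < e, t + e <= T, e < n.+1%:R^-1 &
    forall i, ((e^-1)%:E * \int[mu]_(s in `[t, (t + e)%R]) phi i s
      <= ((1/2) ^+ n)%:E)%E].
  have : \forall e \near 0^'+, forall i,
      (\int[mu]_(s in `[t, (t + e)%R]) phi i s <= ((0 + (1/2) ^+ n) * e)%:E)%E.
    by apply: filter_forall => i; apply: phi0; rewrite exprn_gt0// divr_gt0.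
  move=> H.
  near (0:R)^'+ => e.
  have e0 : 0 < e by [].
  exists e; split => //.
  - rewrite -lerBrDl ltW//; near: e; apply: nbhs_right_lt; by rewrite subr_gt0.
  - move=> i; have /(_ i) : forall i,
      (\int[mu]_(s in `[t, (t + e)%R]) phi i s <= ((0 + (1/2) ^+ n) * e)%:E)%E by near: e.
    rewrite add0r => h.
    apply: le_trans (lee_wpmul2l _ h) _; first by rewrite lee_fin invr_ge0 ltW.
    by rewrite -EFinM lee_fin mulrC mulfK// gt_eqF.
have [eps heps] := choice step.
exists eps; split; try by move=> n; have [] := heps n.
apply: (@squeeze_cvgr _ _ _ _ (cst 0) (fun n => n.+1%:R^-1)).
- by apply: nearW => n; have [e0 _ /ltW -> _] := heps n; rewrite ltW.
- exact: cvg_cst.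
- exact: cvg_harmonic.
Unshelve. all: by end_near. Qed.

(** The hypothesis bounds the unconditional mean, which depends neither on [G] nor
    on the version [g], so the radii may be chosen before [g] is given. The
    average of |g| dominates that of g and has this mean by
    [condE_integral_abs]. *)
Lemma ae_condE_avg_cvg0 (G : set (set Omega)) (t T : R) (X : R * Omega -> R)
    (D g : R -> Omega -> \bar R) (eps : nat -> R) :
  sigma_algebra setT G -> G `<=` measurable ->
  measurable_fun setT X -> (forall z, 0 <= X z) ->
  (forall s w, t <= s <= T -> D s w = (X (s, w))%:E) ->
  is_condE_process P G t T D g ->
  (forall n, 0 < eps n) -> (forall n, t + eps n <= T) ->
  (forall n, ((eps n)^-1)%:E * \int[mu]_(s in `[t, (t + eps n)%R])
     \int[P]_w (X (s, w))%:E <= ((1/2) ^+ n)%:E)%E ->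
  {ae P, forall w, (((eps n)^-1)%:E *
     \int[mu]_(s in `[t, (t + eps n)%R]) g s w)%E @[n --> \oo] --> 0%E}.
Proof.
move=> sG Gm mX X0 DX [mg gE] eps0 epsT epsle.
pose J n : set R := `[t, (t + eps n)%R]%classic.
have mJ n : measurable (J n) by exact: measurable_itv.
have JT n s : J n s -> t <= s <= T.
  by rewrite /J /= in_itv/= => /andP[-> /le_trans]; apply.
pose Y (z : R * Omega) := g z.1 z.2.
have mY n : measurable_fun (J n `*` setT) Y.
  apply: measurable_funS mg.
  - by apply: measurableX => //; exact: measurable_itv.
  - by move=> [s w] [/= /JT h _]; split.
have maY n : measurable_fun (J n `*` setT) (fun z => `|Y z|)%E.
  exact: measurableT_comp.
pose h n w := (((eps n)^-1)%:E * \int[mu]_(s in J n) `|Y (s, w)|)%E.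
have h0 n w : (0 <= h n w)%E.
  by rewrite mule_ge0 ?integral_ge0// lee_fin invr_ge0 ltW.
have mh n : measurable_fun setT (h n).
  apply: emeasurable_funM => //.
  exact: (tonelli_strip P (mJ n) (maY n) (fun=> abse_ge0 _)).1.
have hle n : (\int[P]_w h n w <= ((1/2) ^+ n)%:E)%E.
  apply: le_trans (epsle n); rewrite /h ge0_integralZl//; last 3 first.
  - exact: (tonelli_strip P (mJ n) (maY n) (fun=> abse_ge0 _)).1.
  - by move=> w _; exact: integral_ge0.
  - by rewrite lee_fin invr_ge0 ltW.
  rewrite (tonelli_strip P (mJ n) (maY n) (fun=> abse_ge0 _)).2.
  rewrite (_ : (\int[mu]_(s in J n) _)%E = (\int[mu]_(s in J n) \int[P]_w (X (s, w))%:E)%E)//.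
  apply: eq_integral => s; rewrite inE => /JT sT.
  rewrite (@condE_integral_abs _ _ _ _ G sG Gm (fun w => (X (s, w))%:E))//.
  - by apply/measurable_EFinP; exact: measurable_section.
  - by move=> w; rewrite lee_fin.
  - have [mgs gsE] := gE _ sT; split=> // A GA.
    by rewrite gsE//; apply: eq_integral => w _; rewrite DX.
have : (\sum_(0 <= n <oo) \int[P]_w h n w < +oo)%E.
  apply: (@le_lt_trans _ _ (\sum_(0 <= n <oo) (geometric 1 (1/2) n)%:E)%E).
    apply: lee_nneseries => n _ *; first exact: integral_ge0.
    by rewrite /geometric/= mul1r.
  have half_lt1 : `|1/2| < 1 :> R by rewrite ger0_norm// ltr_pdivrMr// mul1r ltr1n.
  rewrite -(cvg_nneseriesE _ (@cvg_geometric_series R 1 (1/2) half_lt1)) ?ltry// => n.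
  by rewrite mulr_ge0// exprn_ge0.
move=> /(ae_cvg0_summable mh h0); apply: filterS => w hw.
apply/cvg_abse0P; apply: squeeze_cvge hw; last exact: cvg_cst.
apply: nearW => n /=; rewrite abse_ge0/= abseM gee0_abs ?lee_fin ?invr_ge0 ?(ltW (eps0 n))//.
rewrite lee_pmul2l ?lte_fin ?invr_gt0//.
apply: le_abse_integral => //.
exact: (measurable_strip_section w (mJ n) (mY n)).
Qed.

End main.

Theorem lemma3p3 (R : realType) (d : measure_display)
    (Omega : measurableType d) (P : probability Omega R)
    (hP : measure_is_complete P)
    (F : R -> set (set Omega)) (hF : filtration F)
    (T : R) (hT : 0 < T) (m : nat) (p : R) (hp : 1 < p <= 2)
    (f : R -> Omega -> 'rV[R]_m) (hf : Lp_adapted P F p T f) :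
  {ae @lebesgue_measure R, forall t, 0 <= t <= T ->
    let D (i : 'I_m) (s : R) (w : Omega) : \bar R :=
      `|f s w ord0 i - f t w ord0 i|%:E in
    (exists g : 'I_m -> R -> Omega -> \bar R,
      forall i, is_condE_process P (F t) t T (D i) (g i)) /\
    exists eps : nat -> R,
      [/\ forall n, 0 < eps n,
          forall n, t + eps n <= T,
          eps n @[n --> \oo] --> 0 &
          forall g : 'I_m -> R -> Omega -> \bar R,
            (forall i, is_condE_process P (F t) t T (D i) (g i)) ->
            {ae P, forall w, forall i,
              (((eps n)^-1)%:E *
                 \int[@lebesgue_measure R]_(s in `[t, (t + eps n)%R]) g i s w)%E
                @[n --> \oo] --> 0%E}]}.
Proof.
have [hF1 _] := hF.
have p1 : 1 <= p by case/andP: hp => /ltW.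
have [mf _ _] := hf.
pose X (i : 'I_m) : R * Omega -> R :=
  (fun z => f z.1 z.2 ord0 i) \_ (`[0, T] `*` setT).
have mX i : measurable_fun setT (X i).
  by apply/(measurable_restrictT _ _).1; [exact: measurableX|exact: mf].
have XE i s w : 0 <= s <= T -> X i (s, w) = f s w ord0 i.
  by move=> sT; rewrite /X patchE in_setX in_setT andbT mem_set// /= in_itv.
have Leb : {ae @lebesgue_measure R, forall t, forall i, L1_lebesgue_pt P (X i) t}.
  apply: filter_forall => i; apply: ae_L1_lebesgue_pt_real => //.
  exact: (@Lp_adapted_L1 _ _ _ _ F p T m f i p1 (ltW hT) hf).
have neqT : {ae @lebesgue_measure R, forall t, t != T}.
  exists [set T]; split => //; first exact: lebesgue_measure_set1.
  by move=> t /= /negP; rewrite negbK => /eqP.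
move: Leb neqT; apply: filterS2 => t Lt tneT /andP[t0 tT].
pose D (i : 'I_m) (s : R) (w : Omega) : \bar R :=
  `|f s w ord0 i - f t w ord0 i|%:E.
have ltT : t < T by rewrite lt_neqAle tneT.
have [sG Gm] := hF1 t t0.
(* The increment |f_i(s) - f_i(t)|, with f_i extended by 0 outside [0, T] so as
   to be measurable on the whole product space. *)
pose Z i (z : R * Omega) := `|X i z - X i (t, z.2)|.
have mZ i : measurable_fun setT (Z i).
  apply: measurableT_comp => //; apply: measurable_funB => //.
  exact: (measurableT_comp (measurable_section t (mX i)) measurable_snd).
have Z0 i z : 0 <= Z i z by exact: normr_ge0.
have DZ i s w : t <= s <= T -> D i s w = (Z i (s, w))%:E.
  move=> /andP[ts sT]; rewrite /Z /D/= !XE ?t0//.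
  by rewrite sT (le_trans t0).
split.
  have [g hg] := choice (fun i => exists_condE_process P sG Gm (mZ i) (Z0 i) (DZ i)).
  by exists g.
have [eps [eps0 epsT epscvg epsle]] := exists_summable_radii ltT Lt.
exists eps; split => // g hg.
apply: filter_forall => i.
exact: (ae_condE_avg_cvg0 sG Gm (mZ i) (Z0 i) (DZ i) (hg i) eps0 epsT (epsle^~ i)).
Qed.
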